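(* Let $\mathsf R$ be a multivariate Ore extension of a domain $R$, let $\mathsf S$ be its associated graded Ore extension, let $F=\{g_1,\dots,g_u\}\subset\mathsf R^m\setminus\{0\}$ be a finite set, let $\mathsf M:=\mathbb I_L(F)\subset\mathsf R^m$ be the left module it generates, and let $\mathfrak{GM}(F)$ be any left Gebauer–Möller set for $F$. Then the following conditions are equivalent: (1) $F$ is a left Gröbner basis of $\mathsf M$; (2) for $f\in\mathsf R^m\setminus\{0\}$: $f\in\mathsf M$ if and only if $f$ has a left Gröbner representation in terms of $F$; (3) for each $\sigma\in\mathfrak{GM}(F)$, the S-polynomial $\mathfrak S_L(\sigma)$ has a left quasi-Gröbner representation $\mathfrak S_L(\sigma)=\sum_{i=1}^u l_i\star g_i$ in terms of $F$; (4) each $\sigma\in\mathfrak{GM}(F)$ has a lifting; (5) each nonzero $\mathcal T^{(m)}$-homogeneous element of $\ker(\mathfrak s_L)$ has a lifting.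
   Context: **Ore extensions.** $R$ is a (not necessarily commutative) domain with identity. A multivariate Ore extension $\mathsf R=R[Y_1;\alpha_1,\delta_1]\cdots[Y_n;\alpha_n,\delta_n]$ is an iterated Ore extension ($Y_i\star r=\alpha_i(r)Y_i+\delta_i(r)$, $\alpha_i$ an injective ring endomorphism mapping $R$ to $R$, $\delta_i$ an $\alpha_i$-derivation mapping $R$ to $R$, i.e. additive with $\delta_i(rr')=\alpha_i(r)\delta_i(r')+\delta_i(r)r'$) such that $\alpha_j\delta_i=\delta_i\alpha_j$ for $i\ne j$, $\alpha_i\alpha_j=\alpha_j\alpha_i$, $\delta_i\delta_j=\delta_j\delta_i$, and $\alpha_j(Y_i)=Y_i$, $\delta_j(Y_i)=0$ for $i<j$. Its multiplication is $\star$. It is a free left $R$-module on the set of terms $\mathcal T=\{Y_1^{a_1}\cdots Y_n^{a_n}\}$, a commutative monoid whose product is written $\circ$. For $\tau=Y_1^{a_1}\cdots Y_n^{a_n}$ put $\alpha_\tau=\alpha_1^{a_1}\cdots\alpha_n^{a_n}:R\to R$. The associated graded Ore extension $\mathsf S=R[Y_1;\alpha_1]\cdots[Y_n;\alpha_n]$ is the same left $R$-module with multiplication $\ast$ determined by $(a\tau)\ast(b\omega)=a\,\alpha_\tau(b)\,\tau\circ\omega$. **Orderings.** $\mathsf R^m$ has canonical basis $\mathbf e_1,\dots,\mathbf e_m$ and terms $\mathcal T^{(m)}=\{t\mathbf e_i\}$. Fix a term ordering $\prec$ on $\mathcal T$ and a compatible term ordering $<$ on $\mathcal T^{(m)}$: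 a well-ordering with $\omega_1\prec\omega_2\Rightarrow\omega_1t<\omega_2t$ and $t_1<t_2\Rightarrow\omega t_1<\omega t_2$. For $f\ne0$, $\mathbf T(f)$ is its maximal term, $\mathrm{lc}(f)\in R$ the coefficient of $\mathbf T(f)$, and $\mathbf M(f)=\mathrm{lc}(f)\mathbf T(f)$. **Gröbner notions (left).** $F$ is a left (weak) Gröbner basis of $\mathsf M=\mathbb I_L(F)$ if for every $f\in\mathsf M\setminus\{0\}$ one has $\mathbf M(f)=\sum_i a_i\lambda_i\ast\mathbf M(g_{j_i})$ (finite sum) with $a_i\in R\setminus\{0\}$, $\lambda_i\in\mathcal T$, $g_{j_i}\in F$, $\lambda_i\circ\mathbf T(g_{j_i})=\mathbf T(f)$. A left Gröbner representation of $f\neq 0$ in terms of $F$ is $f=\sum_i l_i\star g_i$ with $l_i\in\mathsf R$ and $\mathbf T(l_i)\circ\mathbf T(g_i)\le\mathbf T(f)$ whenever $l_i\ne0$. **Syzygies.** Let $e_1,\dots,e_u$ be the common canonical basis of $\mathsf S^u$ and $\mathsf R^u$ (equal as $R$-modules). Define $\mathfrak s_L:\mathsf S^u\to\mathsf S^m$, $\mathfrak s_L(\sum h_ie_i)=\sum h_i\ast\mathbf M(g_i)$, and $\mathfrak S_L:\mathsf R^u\to\mathsf R^m$, $\mathfrak S_L(\sum h_ie_i)=\sum h_i\star g_i$. For $\sigma=\sum h_ie_i\ne0$ put $v(\sigma)=\max_<\{\mathbf T(h_i)\circ\mathbf T(g_i):h_i\ne0\}\in\mathcal T^{(m)}$ and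 leading form $\mathcal L_L(\sigma)=\sum_{i\in H}\mathbf M(h_i)e_i$, $H=\{i:\mathbf T(h_i)\circ\mathbf T(g_i)=v(\sigma)\}$. A nonzero element $\sum a_i\lambda_ie_i$ ($a_i\in R,\lambda_i\in\mathcal T$) is $\mathcal T^{(m)}$-homogeneous if $\lambda_i\circ\mathbf T(g_i)$ is the same term for all $i$ with $a_i\neq0$. A left Gebauer–Möller set for $F$ is a set of (nonzero) $\mathcal T^{(m)}$-homogeneous generators of the left $\mathsf S$-module $\ker(\mathfrak s_L)$. A homogeneous $\sigma\in\ker(\mathfrak s_L)$ has a lifting if there is $U\in\ker(\mathfrak S_L)$ with $\mathcal L_L(U)=\sigma$. $\mathfrak S_L(\sigma)$ has a left quasi-Gröbner representation if $\mathfrak S_L(\sigma)=\sum_{i=1}^u l_i\star g_i$ with $\mathbf T(l_i)\circ\mathbf T(g_i)<v(\sigma)$ for all $i$ with $l_i\ne0$. *)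

(* Defs.v *)
From HB Require Import structures.
From mathcomp Require Import all_boot all_order all_algebra.
From mathcomp Require Import ssrcomplements freeg mpoly.

Set Implicit Arguments.
Unset Strict Implicit.
Unset Printing Implicit Defensive.

Import GRing.Theory.

Local Open Scope ring_scope.

(* The data (alpha_1, delta_1), ..., (alpha_n, delta_n) of a multivariate Ore *)
(* extension of R, given by their restrictions to R: since alpha_j Y_i = Y_i  *)
(* and delta_j Y_i = 0 for i < j, the maps on R[Y_1;..]..[Y_(j-1);..] are the *)
(* coefficientwise extensions of these (see oreX_mul, map_alphaM and          *)
(* map_deltaM below).                                                         *)
Record ore_data (R : nzRingType) (n : nat) := OreData {
  alpha : 'I_n -> {rmorphism R -> R};
  delta : 'I_n -> {additive R -> R};
  alpha_inj : forall i, injective (alpha i);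
  deltaM : forall i r s, delta i (r * s) = alpha i r * delta i s + delta i r * s;
  alphaC : forall i j r, alpha i (alpha j r) = alpha j (alpha i r);
  deltaC : forall i j r, delta i (delta j r) = delta j (delta i r);
  alpha_deltaC : forall i j r, i != j ->
    alpha j (delta i r) = delta i (alpha j r)
}.

Section LinearExtension.

Variables (R : nzRingType) (n : nat).
Implicit Types (f p q : {mpoly R[n]}).

Lemma map_mpolyZX (h : {additive R -> R}) c (m : 'X_{1..n}) :
  map_mpoly h (c *: 'X_[m]) = h c *: 'X_[m].
Proof.
apply/mpolyP=> k; rewrite mcoeff_map_mpoly !mcoeffZ !mcoeffX.
by case: eqP => _; rewrite ?mulr1 // !mulr0 raddf0.
Qed.

Lemma map_mpolyMX (h : {additive R -> R}) p (m : 'X_{1..n}) :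
  map_mpoly h (p * 'X_[m]) = map_mpoly h p * 'X_[m].
Proof.
rewrite [p]mpolyE mulr_suml !raddf_sum /= mulr_suml.
by apply: eq_bigr => k _; rewrite -scalerAl -mpolyXD !map_mpolyZX -scalerAl -mpolyXD.
Qed.

Definition lin_ext (F : 'X_{1..n} -> {mpoly R[n]}) f :=
  \sum_(m <- msupp f) f@_m *: F m.

Lemma lin_extE F f (k : nat) : (msize f <= k)%N ->
  lin_ext F f = \sum_(m : 'X_{1..n < k}) f@_m *: F m.
Proof.
move=> le_fk; rewrite /lin_ext (big_mksub 'X_{1..n < k}) /=.
- rewrite big_rmcond //= => m /memN_msupp_eq0 ->; exact: scale0r.
- exact: msupp_uniq.
by move=> m /msize_mdeg_lt /leq_trans; apply.
Qed.

Lemma lin_extD F p q : lin_ext F (p + q) = lin_ext F p + lin_ext F q.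
Proof.
pose k := maxn (msize (p + q)) (maxn (msize p) (msize q)).
rewrite !(@lin_extE F _ k) ?/k ?leq_max ?leqnn ?orbT // -big_split /=.
by apply: eq_bigr => m _; rewrite mcoeffD scalerDl.
Qed.

Lemma lin_ext0 F : lin_ext F 0 = 0.
Proof. by rewrite /lin_ext msupp0 big_nil. Qed.

Lemma lin_extZ F c p : lin_ext F (c *: p) = c *: lin_ext F p.
Proof.
pose k := maxn (msize (c *: p)) (msize p).
rewrite !(@lin_extE F _ k) ?/k ?leq_max ?leqnn ?orbT // scaler_sumr.
by apply: eq_bigr => m _; rewrite mcoeffZ scalerA.
Qed.

Lemma lin_extX F m : lin_ext F 'X_[m] = F m.
Proof. by rewrite /lin_ext msuppX big_seq1 mcoeffX eqxx scale1r. Qed.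

Lemma lin_ext_sum F (I : Type) (s : seq I) (G : I -> {mpoly R[n]}) :
  lin_ext F (\sum_(i <- s) G i) = \sum_(i <- s) lin_ext F (G i).
Proof. exact: (big_morph _ (lin_extD F) (lin_ext0 F)). Qed.

End LinearExtension.

Section OreMultiplication.

Variables (R : nzRingType) (n : nat) (D : ore_data R n).
Implicit Types (f g h : {mpoly R[n]}).

(* The left R-module underlying the extension is {mpoly R[n]}, with 'X_[t]    *)
(* for the term t.  The product with 'X_i below is that of {mpoly R[n]}, in   *)
(* which variables are central: it only shifts terms.  So oreX i f is         *)
(* alpha_i(f) Y_i + delta_i(f), the product of Y_i and f in the extension.    *)
Definition oreX (i : 'I_n) f : {mpoly R[n]} :=
  map_mpoly (alpha D i) f * 'X_i + map_mpoly (delta D i) f.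

(* g |-> Y_1^t_1 (Y_2^t_2 ( ... (Y_n^t_n g)))                                 *)
Definition oreXn (t : 'X_{1..n}) g : {mpoly R[n]} :=
  foldr (fun i h => iter (t i) (oreX i) h) g (enum 'I_n).

Definition ore_mul f g : {mpoly R[n]} :=
  \sum_(t <- msupp f) f@_t *: oreXn t g.

Lemma ore_mulE f g : ore_mul f g = lin_ext (oreXn ^~ g) f.
Proof. by []. Qed.

Lemma delta1 i : delta D i 1 = 0.
Proof.
have /eqP := deltaM D i 1 1.
by rewrite !mulr1 rmorph1 mul1r -subr_eq0 opprD addrA subrr sub0r oppr_eq0 => /eqP.
Qed.

Lemma oreXD i : {morph oreX i : f g / f + g}.
Proof. by move=> f g; rewrite /oreX !raddfD /= mulrDl addrACA. Qed.

Lemma oreX0 i : oreX i 0 = 0.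
Proof. by rewrite /oreX !raddf0 mul0r addr0. Qed.

Lemma oreX_sum i (I : Type) (s : seq I) (G : I -> {mpoly R[n]}) :
  oreX i (\sum_(k <- s) G k) = \sum_(k <- s) oreX i (G k).
Proof. exact: (big_morph _ (oreXD i) (oreX0 i)). Qed.

Lemma oreXZ i c f : oreX i (c *: f) = alpha D i c *: oreX i f + delta D i c *: f.
Proof.
apply/mpolyP=> m; rewrite /oreX.
have ->: map_mpoly (alpha D i) (c *: f) = alpha D i c *: map_mpoly (alpha D i) f.
  by apply/mpolyP=> k; rewrite !(mcoeff_map_mpoly, mcoeffZ) /= rmorphM.
rewrite -scalerAl !(mcoeffD, mcoeffZ, mcoeff_map_mpoly) deltaM mulrDr addrA //.
Qed.

Lemma oreX_X i m : oreX i 'X_[m] = 'X_[m + U_(i)].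
Proof.
rewrite /oreX -['X_[m]]scale1r !map_mpolyZX /= delta1 rmorph1 scale0r addr0 !scale1r.
by rewrite mpolyXD.
Qed.

Lemma oreXC i j f : oreX i (oreX j f) = oreX j (oreX i f).
Proof.
have [-> //|neq_ij] := eqVneq i j.
rewrite /oreX !raddfD /= !map_mpolyMX !mulrDl -!mulrA.
rewrite -!mpolyXD [X in 'X_[X]]addmC.
have mapC (a b : {additive R -> R}) (abC : forall r, a (b r) = b (a r))
    (p : {mpoly R[n]}) :
    map_mpoly a (map_mpoly b p) = map_mpoly b (map_mpoly a p).
  by apply/mpolyP=> m; rewrite !mcoeff_map_mpoly.
rewrite (mapC (alpha D i) (alpha D j) (alphaC D i j)).
rewrite (mapC (delta D i) (delta D j) (deltaC D i j)).
rewrite (mapC (alpha D i) (delta D j)); last first.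
  by move=> r; apply: alpha_deltaC; rewrite eq_sym.
rewrite (mapC (delta D i) (alpha D j)); last first.
  by move=> r; rewrite -alpha_deltaC.
by rewrite -!addrA; congr (_ + _); rewrite addrCA.
Qed.

Lemma oreXnD t : {morph oreXn t : f g / f + g}.
Proof.
move=> f g; rewrite /oreXn; elim: (enum _) => //= i s ->.
by elim: (t i) => //= k ->; rewrite oreXD.
Qed.

Lemma oreXn0 t : oreXn t 0 = 0.
Proof.
rewrite /oreXn; elim: (enum _) => //= i s ->.
by elim: (t i) => //= k ->; rewrite oreX0.
Qed.

Lemma oreXnX t m : oreXn t 'X_[m] = 'X_[m + t].
Proof.
have iterX i k m' : iter k (oreX i) 'X_[m'] = 'X_[m' + U_(i) *+ k].
  elim: k => [|k /= ->]; first by rewrite mulm0n addm0.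
  by rewrite oreX_X mulmSr addmA.
rewrite /oreXn; have : foldr (fun i h => iter (t i) (oreX i) h) 'X_[m] (enum 'I_n)
  = 'X_[m + \big[+%MM/0%MM]_(i <- enum 'I_n) (U_(i) *+ t i)%MM].
  elim: (enum _) => [|i s /= ->]; first by rewrite big_nil addm0.
  by rewrite iterX big_cons -addmA [X in (m + X)%MM]addmC.
by move=> ->; rewrite big_enum /= -multinomUE_id.
Qed.

Lemma oreXn_oreX t i f : oreXn t (oreX i f) = oreX i (oreXn t f).
Proof.
rewrite /oreXn; elim: (enum _) => //= j s ->.
by elim: (t j) => //= k ->; rewrite oreXC.
Qed.

Lemma oreXnU i f : oreXn U_(i) f = oreX i f.
Proof.
have foldr_id s : i \notin s ->
    foldr (fun j h => iter (U_(i)%MM j) (oreX j) h) f s = f.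
  elim: s => //= j s IHs; rewrite inE negb_or => /andP[neq_ij /IHs ->].
  by rewrite mnm1E (negbTE neq_ij).
rewrite /oreXn; have := mem_enum 'I_n i; have := enum_uniq 'I_n.
elim: (enum _) => //= j s IHs /andP[j_s s_uniq]; rewrite !inE.
have [ij _|neq_ij /= i_s] := eqVneq i j.
  by rewrite ij mnm1E eqxx -ij foldr_id // ij.
by rewrite IHs // mnm1E (negbTE neq_ij).
Qed.

Lemma oreXn_add t w f : oreXn (t + w) f = oreXn t (oreXn w f).
Proof.
have oreXn_iter i k s g :
    foldr (fun i h => iter (t i) (oreX i) h) (iter k (oreX i) g) s =
    iter k (oreX i) (foldr (fun i h => iter (t i) (oreX i) h) g s).
  elim: s => //= j s ->; elim: (t j) => //= l ->.
  by elim: k => //= k <-; rewrite oreXC.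
rewrite /oreXn; elim: (enum _) => //= i s ->.
by rewrite mnmDE iterD oreXn_iter.
Qed.

Lemma ore_mulXl t g : ore_mul 'X_[t] g = oreXn t g.
Proof. by rewrite ore_mulE lin_extX. Qed.

Lemma ore_mulDl : left_distributive ore_mul +%R.
Proof. by move=> f g h; rewrite !ore_mulE lin_extD. Qed.

Lemma ore_mulDr : right_distributive ore_mul +%R.
Proof.
move=> f g h; rewrite /ore_mul -big_split /=.
by apply: eq_bigr => t _; rewrite oreXnD scalerDr.
Qed.

Lemma ore_mulZl c f g : c *: ore_mul f g = ore_mul (c *: f) g.
Proof. by rewrite !ore_mulE lin_extZ. Qed.

Lemma ore_mul1 : left_id 1 ore_mul.
Proof.
move=> g; rewrite -mpolyX0 ore_mulXl /oreXn.
by elim: (enum _) => //= i s ->; rewrite mnm0E.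
Qed.

Lemma ore_mulr1 : right_id 1 ore_mul.
Proof.
move=> f; rewrite [RHS]mpolyE; apply: eq_bigr => t _.
by rewrite -mpolyX0 oreXnX add0m.
Qed.

Lemma ore_mul_oreX i g h : ore_mul (oreX i g) h = oreX i (ore_mul g h).
Proof.
rewrite [g]mpolyE oreX_sum !ore_mulE !lin_ext_sum oreX_sum.
apply: eq_bigr => t _; rewrite lin_extZ lin_extX !oreXZ lin_extD !lin_extZ.
by rewrite oreX_X !lin_extX oreXn_add -oreXn_oreX -oreXnU.
Qed.

Lemma ore_mulA : associative ore_mul.
Proof.
move=> f g h; have mul_oreXn t p q :
    ore_mul (oreXn t p) q = oreXn t (ore_mul p q).
  rewrite /oreXn; elim: (enum _) => //= i s <-.
  by elim: (t i) => //= k <-; rewrite ore_mul_oreX.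
rewrite [RHS]ore_mulE [X in lin_ext _ X]/ore_mul lin_ext_sum.
by apply: eq_bigr => t _; rewrite -ore_mulE -ore_mulZl mul_oreXn.
Qed.

End OreMultiplication.

(* The multivariate Ore extension R[Y_1;alpha_1,delta_1]..[Y_n;alpha_n,delta_n] *)
Definition ore (R : nzRingType) (n : nat) (D : ore_data R n) : Type :=
  {mpoly R[n]}.

Section OreRing.

Variables (R : nzRingType) (n : nat) (D : ore_data R n).

HB.instance Definition _ := GRing.Lmodule.copy (ore D) {mpoly R[n]}.
HB.instance Definition _ := GRing.Zmodule_isNzRing.Build (ore D)
  (@ore_mulA R n D) (@ore_mul1 R n D) (@ore_mulr1 R n D)
  (@ore_mulDl R n D) (@ore_mulDr R n D) (oner_neq0 {mpoly R[n]}).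
HB.instance Definition _ := GRing.Lmodule_isLalgebra.Build R (ore D)
  (@ore_mulZl R n D).

Implicit Types (f g : ore D).

Lemma ore_mulXX t w : ('X_[t] : ore D) * ('X_[w] : ore D) = 'X_[(t + w)%MM].
Proof. by rewrite [LHS]ore_mulXl oreXnX addmC. Qed.

Lemma oreX_scalar i (r : R) : ('X_i : ore D) * r%:A =
  alpha D i r *: ('X_i : ore D) + (delta D i r)%:A.
Proof.
rewrite [LHS]ore_mulXl oreXnU [LHS]oreXZ; congr (_ *: _ + _).
by have := oreX_X D i 0%MM; rewrite add0m mpolyX0.
Qed.

Definition map_alpha j f : ore D := map_mpoly (alpha D j) f.
Definition map_delta j f : ore D := map_mpoly (delta D j) f.

Lemma oreX_mul j f :
  ('X_j : ore D) * f = map_alpha j f * ('X_j : ore D) + map_delta j f.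
Proof.
rewrite [LHS]ore_mulXl oreXnU; congr (_ + _).
rewrite [RHS]/(ore_mul _ _ _) /ore_mul [X in X * _]mpolyE mulr_suml.
apply: eq_bigr => t _; rewrite oreXnX addmC mpolyXD.
by rewrite -scalerAl.
Qed.

Lemma map_alpha_inj j : injective (@map_alpha j).
Proof.
move=> f g /mpolyP eq_fg; apply/mpolyP => t; apply: (@alpha_inj _ _ D j).
by have := eq_fg t; rewrite /map_alpha !mcoeff_map_mpoly.
Qed.

Lemma map_alphaM j f g : (forall t, t \in msupp f -> t j = 0%N) ->
  map_alpha j (f * g) = map_alpha j f * map_alpha j g.
Proof.
move=> f_j; have mapZ c (p : {mpoly R[n]}) :
    map_mpoly (alpha D j) (c *: p) = alpha D j c *: map_mpoly (alpha D j) p.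
  by apply/mpolyP => t; rewrite !(mcoeff_map_mpoly, mcoeffZ) /= rmorphM.
have mapXC i p : i != j -> map_mpoly (alpha D j) (oreX D i p) =
    oreX D i (map_mpoly (alpha D j) p).
  move=> neq_ij; rewrite /oreX raddfD /= map_mpolyMX.
  congr (_ * _ + _); apply/mpolyP => t; rewrite !mcoeff_map_mpoly /=.
    exact: alphaC.
  exact: alpha_deltaC.
have mapXn (t : 'X_{1..n}) p : t j = 0%N -> map_mpoly (alpha D j) (oreXn D t p) =
    oreXn D t (map_mpoly (alpha D j) p).
  move=> tj; rewrite /oreXn; elim: (enum _) => //= i s <-.
  have [->|neq_ij] := eqVneq i j; first by rewrite tj.
  by elim: (t i) => //= k <-; rewrite mapXC.
rewrite [RHS]ore_mulE [X in lin_ext _ X]/map_alpha [X in map_mpoly _ X]mpolyE.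
rewrite [LHS]/map_alpha [X in map_mpoly _ X]/(ore_mul D f g) /ore_mul.
rewrite !raddf_sum lin_ext_sum !big_seq; apply: eq_bigr => t /f_j tj /=.
by rewrite mapZ map_mpolyZX lin_extZ lin_extX mapXn.
Qed.

Lemma map_deltaM j f g : (forall t, t \in msupp f -> t j = 0%N) ->
  map_delta j (f * g) = map_alpha j f * map_delta j g + map_delta j f * g.
Proof.
move=> f_j; have := mulrA ('X_j : ore D) f g.
rewrite !oreX_mul map_alphaM // mulrDl -!mulrA oreX_mul mulrDr -addrA.
by move/addrI.
Qed.

End OreRing.

Section Graded.

Variables (R : nzRingType) (n : nat) (D : ore_data R n).

Let delta0 : 'I_n -> {additive R -> R} := fun=> GRing.null_fun R.

Fact graded_deltaM i r s :
  delta0 i (r * s) = alpha D i r * delta0 i s + delta0 i r * s.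
Proof. by rewrite /= mulr0 mul0r addr0. Qed.

Fact graded_deltaC i j r : delta0 i (delta0 j r) = delta0 j (delta0 i r).
Proof. by []. Qed.

Fact graded_alpha_deltaC i j r : i != j ->
  alpha D j (delta0 i r) = delta0 i (alpha D j r).
Proof. by rewrite /= rmorph0. Qed.

Definition graded_data : ore_data R n :=
  OreData (@alpha_inj R n D) graded_deltaM (alphaC D) graded_deltaC
    graded_alpha_deltaC.

End Graded.

(* The associated graded Ore extension R[Y_1;alpha_1]..[Y_n;alpha_n]          *)
Notation gore D := (ore (graded_data D)).

(* alpha_t = alpha_1^t_1 o ... o alpha_n^t_n                                  *)
Definition alpha_term (R : nzRingType) (n : nat) (D : ore_data R n)
    (t : 'X_{1..n}) (r : R) : R :=
  foldr (fun i s => iter (t i) (alpha D i) s) r (enum 'I_n).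

Lemma gore_mulZX (R : nzRingType) (n : nat) (D : ore_data R n) a b t w :
  (a *: 'X_[t] : gore D) * (b *: 'X_[w] : gore D) =
  (a * alpha_term D t b) *: 'X_[(t + w)%MM].
Proof.
have gX i c p : oreX (graded_data D) i (c *: p) =
    alpha D i c *: oreX (graded_data D) i p.
  by rewrite oreXZ /= scale0r addr0.
have gXn : oreXn (graded_data D) t (b *: 'X_[w]) =
    alpha_term D t b *: oreXn (graded_data D) t 'X_[w].
  rewrite /oreXn /alpha_term; elim: (enum _) => //= i s ->.
  by elim: (t i) => //= k ->; rewrite gX.
by rewrite [LHS]ore_mulE lin_extZ lin_extX gXn oreXnX scalerA addmC.
Qed.

Definition well_ordering (T : eqType) (lt : rel T) : Prop :=
  [/\ irreflexive lt, transitive lt,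
      forall x y, x != y -> lt x y || lt y x
    & well_founded (fun x y => lt x y)].

Section Maximum.

Variables (T : eqType) (lt : rel T).

Definition max_of (x0 : T) (s : seq T) : T :=
  if s is x :: s' then foldl (fun y z => if lt y z then z else y) x s' else x0.

Lemma max_ofP x0 s : well_ordering lt -> s != [::] ->
  max_of x0 s \in s /\ {in s, forall y, y = max_of x0 s \/ lt y (max_of x0 s)}.
Proof.
case=> _ lt_trans lt_total _; case: s => //= x s _.
elim: s x => [|y s IHs] x /=.
  by rewrite mem_head; split=> // y; rewrite inE => /eqP; left.
set z := if _ then _ else _; set M := foldl _ _ _.
have [zM zmax] := IHs z; rewrite -/M in zM zmax.
have z_xy : z \in [:: x; y] by rewrite /z; case: ifP; rewrite !inE eqxx ?orbT.
have le_z w : w \in [:: x; y] -> w = z \/ lt w z.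
  rewrite /z !inE; have [xy|nxy] := boolP (lt x y).
    by case/orP=> /eqP ->; [right | left].
  case/orP=> /eqP ->; first by left.
  have [->|neq_xy] := eqVneq y x; first by left.
  by right; have := lt_total _ _ neq_xy; rewrite (negbTE nxy) orbF.
split=> [|w].
  move: zM; rewrite inE => /orP[/eqP ->|sM]; last by rewrite !inE sM !orbT.
  by rewrite -[x :: _]/([:: x; y] ++ s) mem_cat z_xy.
rewrite -[x :: _]/([:: x; y] ++ s) mem_cat => /orP[/le_z|sw]; last first.
  by apply: zmax; rewrite inE sw orbT.
have := zmax z (mem_head _ _) => -[<- //|lt_zM] [->|lt_wz]; right=> //.
exact: lt_trans lt_wz lt_zM.
Qed.

End Maximum.

(* The term t e_i of the free module of rank m.+1, as a pair (t, i).          *)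
Definition mterm (n m : nat) : eqType := ('X_{1..n} * 'I_m.+1)%type.

(* t o (t' e_i) = (t o t') e_i; the product of terms adds exponents.          *)
Definition term_act (n m : nat) (t : 'X_{1..n}) (s : mterm n m) : mterm n m :=
  ((t + s.1)%MM, s.2).

Definition term_ordering (n : nat) (prec : rel 'X_{1..n}) : Prop :=
  well_ordering prec /\
  forall w t1 t2, prec t1 t2 -> prec (w + t1)%MM (w + t2)%MM.

Definition compatible_term_ordering (n m : nat) (prec : rel 'X_{1..n})
    (lt : rel (mterm n m)) : Prop :=
  [/\ well_ordering lt,
      forall w1 w2 t, prec w1 w2 -> lt (term_act w1 t) (term_act w2 t)
    & forall w t1 t2, lt t1 t2 -> lt (term_act w t1) (term_act w t2)].

Section LeadingTerms.

Variables (R : nzRingType) (n m : nat).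
Variables (prec : rel 'X_{1..n}) (lt : rel (mterm n m)).

(* The next notions only depend on the left R-module {mpoly R[n]} common to   *)
(* the Ore extension and to its associated graded extension; the leading      *)
(* terms of 0 are junk values.                                                *)

Definition lead_term (h : {mpoly R[n]}) : 'X_{1..n} :=
  max_of prec 0%MM (msupp h).

Definition lead_monom (h : {mpoly R[n]}) : {mpoly R[n]} :=
  h@_(lead_term h) *: 'X_[lead_term h].

Definition vsupp (f : 'rV[{mpoly R[n]}]_m.+1) : seq (mterm n m) :=
  [seq (t, i) | i <- enum 'I_m.+1, t <- msupp (f ord0 i)].

Definition vlead_term (f : 'rV[{mpoly R[n]}]_m.+1) : mterm n m :=
  max_of lt (0%MM, ord0) (vsupp f).

Definition vlead_coef (f : 'rV[{mpoly R[n]}]_m.+1) : R :=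
  (f ord0 (vlead_term f).2)@_(vlead_term f).1.

Definition vlead_monom (f : 'rV[{mpoly R[n]}]_m.+1) : 'rV[{mpoly R[n]}]_m.+1 :=
  \row_i (if i == (vlead_term f).2
          then vlead_coef f *: 'X_[(vlead_term f).1] else 0).

Variables (u : nat) (g : 'I_u -> 'rV[{mpoly R[n]}]_m.+1).

Definition syz_degree (s : 'rV[{mpoly R[n]}]_u) : mterm n m :=
  max_of lt (0%MM, ord0)
    [seq term_act (lead_term (s ord0 i)) (vlead_term (g i))
       | i <- enum 'I_u & s ord0 i != 0].

Definition lead_form (s : 'rV[{mpoly R[n]}]_u) : 'rV[{mpoly R[n]}]_u :=
  \row_i (if (s ord0 i != 0) &&
             (term_act (lead_term (s ord0 i)) (vlead_term (g i)) == syz_degree s)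
          then lead_monom (s ord0 i) else 0).

Definition homogeneous (s : 'rV[{mpoly R[n]}]_u) : Prop :=
  s != 0 /\
  exists (a : 'I_u -> R) (t : 'I_u -> 'X_{1..n}) (d : mterm n m),
    (forall i, s ord0 i = a i *: 'X_[t i]) /\
    (forall i, a i != 0 -> term_act (t i) (vlead_term (g i)) = d).

End LeadingTerms.

(* x belongs to the left A-submodule generated by the set G.                  *)
Definition left_span (A : nzRingType) (V : lmodType A) (G : V -> Prop) (x : V)
    : Prop :=
  exists s : seq (A * V),
    (forall p, p \in s -> G p.2) /\ x = \sum_(p <- s) p.1 *: p.2.

Section GroebnerBases.

Variables (R : nzRingType) (n m u : nat) (D : ore_data R n).
Variables (prec : rel 'X_{1..n}) (lt : rel (mterm n m)).
Variable g : 'I_u -> 'rV[ore D]_m.+1.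

Definition in_left_module (f : 'rV[ore D]_m.+1) : Prop :=
  left_span (fun x => exists i, x = g i) f.

Definition left_groebner_basis : Prop :=
  forall f, in_left_module f -> f != 0 ->
  exists s : seq (R * 'X_{1..n} * 'I_u),
    (forall p, p \in s -> p.1.1 != 0 /\
       term_act p.1.2 (vlead_term lt (g p.2)) = vlead_term lt f) /\
    (vlead_monom lt f : 'rV[gore D]_m.+1) =
      \sum_(p <- s) (p.1.1 *: 'X_[p.1.2] : gore D) *:
                    (vlead_monom lt (g p.2) : 'rV[gore D]_m.+1).

Definition left_groebner_representation (f : 'rV[ore D]_m.+1) : Prop :=
  exists l : 'I_u -> ore D,
    f = \sum_i l i *: g i /\
    forall i, l i != 0 ->
      let t := term_act (lead_term prec (l i)) (vlead_term lt (g i)) in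
      t = vlead_term lt f \/ lt t (vlead_term lt f).

Definition graded_syz_map (s : 'rV[gore D]_u) : 'rV[gore D]_m.+1 :=
  \sum_i s ord0 i *: (vlead_monom lt (g i) : 'rV[gore D]_m.+1).

Definition syz_map (s : 'rV[ore D]_u) : 'rV[ore D]_m.+1 :=
  \sum_i s ord0 i *: g i.

Definition gebauer_moeller_set (GM : 'rV[gore D]_u -> Prop) : Prop :=
  (forall s, GM s -> homogeneous lt g s /\ graded_syz_map s = 0) /\
  (forall s, graded_syz_map s = 0 -> left_span GM s).

Definition has_lifting (s : 'rV[gore D]_u) : Prop :=
  exists U : 'rV[ore D]_u,
    [/\ U != 0, syz_map U = 0 & lead_form prec lt g U = s].

Definition quasi_groebner_representation (s : 'rV[gore D]_u) : Prop :=
  exists l : 'I_u -> ore D,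
    syz_map s = \sum_i l i *: g i /\
    forall i, l i != 0 ->
      lt (term_act (lead_term prec (l i)) (vlead_term lt (g i)))
         (syz_degree prec lt g s).

End GroebnerBases.

(* Main.v *)
(* Grade the syzygy modules by giving e_i the degree T(g_i).  The products of  *)
(* the Ore extension and of its associated graded extension agree up to terms  *)
(* of smaller degree, because the delta_i only produce smaller terms; hence a  *)
(* lifting of a homogeneous syzygy s of degree d is just an element U of the   *)
(* kernel of S_L all of whose terms differ from s below d.  Subtracting a      *)
(* quasi-Groebner representation of S_L(s) from s is then the same as lifting  *)
(* s, and liftings extend from generators to all homogeneous syzygies by       *)
(* taking the degree d part of the coefficients.  If every homogeneous syzygy  *)
(* lifts, the top degree part of a representation of f can be cancelled as     *)
(* long as it exceeds T(f), which by well-foundedness ends with M(f) as a      *)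
(* combination of the M(g_i); conversely such combinations reduce f to 0.      *)

Require Import Defs.
From HB Require Import structures.
From mathcomp Require Import all_boot all_order all_algebra.
From mathcomp Require Import freeg mpoly.

Set Implicit Arguments.
Unset Strict Implicit.
Unset Printing Implicit Defensive.

Import GRing.Theory.

Local Open Scope ring_scope.

(** Let the basis vector e_i of the syzygy modules have degree T(g_i), and let the degrees of an
    element of R^m be its terms. A product in the graded extension adds degrees exactly, while a
    derivation step keeps an exponent that Y_i would have raised. So the two products agree up to
    strictly smaller degree ([degrees_in_mul_graded]), and S_L and s_L agree to top order
    ([comb_graded]). A lifting of a homogeneous s of degree d is then a U in ker S_L with U - s
    below d ([lead_form_homogeneousP]), a linear condition.

    The conditions imply each other in a cycle. (1) to (2): subtract from f the Ore combination that
    has M(f) as leading part; the leading term drops, so the division ends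
    ([groebner_representation]). (2) to (3): s_L(s) = 0 puts S_L(s) below d, and a Groebner
    representation stays below T(S_L(s)) or at it. (3) to (4): subtract the representation from s.
    (4) to (5): expand s in the generators and lift the degree d part of each summand
    ([liftable_lmul], [liftable_span]). (5) to (1): while a representation of f has degree above
    T(f), its top part is a syzygy whose lifting can be subtracted ([weak_groebner_of_lifting]). *)

Lemma mnm_ind n (P : 'X_{1..n} -> Prop) :
  P 0%MM -> (forall i t, P t -> P (U_(i) + t)%MM) -> forall t, P t.
Proof.
move=> P0 PS t; elim: {t}(mdeg t) {-2}t (erefl (mdeg t)) => [|d IHd] t.
  by move/eqP; rewrite mdeg_eq0 => /eqP ->.
move=> td; have [i ti] : exists i, t i != 0%N.
  apply/existsP; rewrite -negb_forall; apply: contraPN td => /forallP t0.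
  move/eqP; apply/negP; rewrite (_ : t = 0%MM) ?mdeg0 //.
  by apply/mnmP=> i; rewrite mnm0E (eqP (t0 i)).
have tE : t = (U_(i) + (t - U_(i)))%MM by rewrite addmC submK // lep1mP.
rewrite tE; apply/PS/IHd; have /eqP := td.
by rewrite {1}tE mdegD mdeg1 add1n eqSS => /eqP.
Qed.

(** * Degrees of the terms of a polynomial *)

Section DegreesIn.

Variables (R : nzRingType) (n m : nat).
Implicit Types (P Q : pred (mterm n m)) (wt d : mterm n m) (p q : {mpoly R[n]}).

(* Every term k of q, as a coefficient of a generator of degree wt, has its *)
(* degree k o wt in P.  The generators are those of R^m, with wt = e_i, and *)
(* those of the syzygy module R^u, with wt = T(g_i). *)
Definition degrees_in P wt q : Prop :=
  forall k, q@_k != 0 -> P (term_act k wt).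

Lemma degrees_in_sub P Q wt q : {subset P <= Q} ->
  degrees_in P wt q -> degrees_in Q wt q.
Proof. by move=> sPQ qP k /qP /sPQ. Qed.

Lemma degrees_in0 P wt : degrees_in P wt 0.
Proof. by move=> k; rewrite mcoeff0 eqxx. Qed.

Lemma degrees_inD P wt p q :
  degrees_in P wt p -> degrees_in P wt q -> degrees_in P wt (p + q).
Proof.
move=> pP qP k; rewrite mcoeffD.
have [p0|/pP //] := eqVneq p@_k 0; have [q0|/qP //] := eqVneq q@_k 0.
by rewrite p0 q0 addr0 eqxx.
Qed.

Lemma degrees_inN P wt q : degrees_in P wt q -> degrees_in P wt (- q).
Proof. by move=> qP k; rewrite mcoeffN oppr_eq0 => /qP. Qed.

Lemma degrees_inB P wt p q :
  degrees_in P wt p -> degrees_in P wt q -> degrees_in P wt (p - q).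
Proof. by move=> pP qP; apply/degrees_inD/degrees_inN. Qed.

Lemma degrees_inZ P wt c q : degrees_in P wt q -> degrees_in P wt (c *: q).
Proof.
move=> qP k; rewrite mcoeffZ => cq; apply: qP.
by apply: contraNneq cq => ->; rewrite mulr0.
Qed.

Lemma degrees_in_sum P wt (I : eqType) (r : seq I) (F : I -> {mpoly R[n]}) :
  (forall i, i \in r -> degrees_in P wt (F i)) ->
  degrees_in P wt (\sum_(i <- r) F i).
Proof.
move=> FP; rewrite big_seq.
by elim/big_rec: _ => [|i p /FP]; [apply: degrees_in0 | apply: degrees_inD].
Qed.

Lemma degrees_in_map P wt (h : {additive R -> R}) q :
  degrees_in P wt q -> degrees_in P wt (map_mpoly h q).
Proof.
move=> qP k; rewrite mcoeff_map_mpoly => hq; apply: qP.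
by apply: contraNneq hq => ->; rewrite raddf0.
Qed.

Lemma degrees_inMX P wt t q : degrees_in [pred x | P (term_act t x)] wt q ->
  degrees_in P wt (q * 'X_[t]).
Proof.
move=> qP k; rewrite -mcoeff_msupp (perm_mem (msuppMX q t)) => /mapP[w qw ->].
rewrite mcoeff_msupp in qw.
by have /= := qP w qw; rewrite /term_act /= addmA.
Qed.

(* The part of q of degree d; since k |-> k o wt is injective, it has at most *)
(* one term, whose exponent is d.1 - wt.1. *)
Definition component d wt q : {mpoly R[n]} :=
  let k := (d.1 - wt.1)%MM in if term_act k wt == d then q@_k *: 'X_[k] else 0.

Lemma mcoeff_component d wt q k :
  (component d wt q)@_k = if term_act k wt == d then q@_k else 0.
Proof.
rewrite /component; set w := (_ - _)%MM.
have [kd|nkd] := eqVneq (term_act k wt) d.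
  have -> : w = k by rewrite /w -kd /= addmK.
  by rewrite kd eqxx mcoeffZ mcoeffX eqxx mulr1.
case: eqP => [wd|_]; last exact: mcoeff0.
rewrite mcoeffZ mcoeffX; have [wk|_] := eqVneq; last by rewrite mulr0.
by rewrite -wk wd eqxx in nkd.
Qed.

End DegreesIn.

(** * Degrees in graded products *)

Section OreDegrees.

Variables (R : nzRingType) (n m : nat) (D : ore_data R n).
Implicit Types (P Q : pred (mterm n m)) (wt d e : mterm n m).
Implicit Types (p q h : {mpoly R[n]}).

Lemma term_actA t w d : term_act (t + w)%MM d = term_act t (term_act w d).
Proof. by rewrite /term_act /= addmA. Qed.

Lemma term_act0 d : term_act 0%MM d = d.
Proof. by case: d => t i; rewrite /term_act /= add0m. Qed.

Lemma oreXn0l q : oreXn D 0%MM q = q.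
Proof. by rewrite -ore_mulXl mpolyX0 ore_mul1. Qed.

End OreDegrees.

Section GradedDegrees.

Variables (R : nzRingType) (n m : nat) (D : ore_data R n).
Implicit Types (P Q : pred (mterm n m)) (wt d e : mterm n m).
Implicit Types (p q h : {mpoly R[n]}).

Lemma oreX_graded i q :
  oreX D i q = oreX (graded_data D) i q + map_mpoly (delta D i) q.
Proof.
rewrite /oreX; congr (_ + _); rewrite -[LHS]addr0; congr (_ + _).
by apply/mpolyP => k; rewrite mcoeff_map_mpoly mcoeff0.
Qed.

(** Without derivations, multiplication by [t] only twists coefficients and shifts every exponent by
    exactly [t]. *)
Lemma degrees_in_graded_oreXn P wt t q :
  degrees_in [pred x | P (term_act t x)] wt q ->
  degrees_in P wt (oreXn (graded_data D) t q).
Proof.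
elim/mnm_ind: t P => [|i t IHt] P qP.
  by rewrite oreXn0l; apply: degrees_in_sub qP => x; rewrite !inE term_act0.
rewrite oreXn_add oreXnU; apply: degrees_inD; last first.
  by move=> k; rewrite mcoeff_map_mpoly eqxx.
apply/degrees_inMX/degrees_in_map/IHt; apply: degrees_in_sub qP => x.
by rewrite !inE term_actA.
Qed.

Lemma degrees_in_graded_mul P wt h q :
  (forall t, h@_t != 0 -> degrees_in [pred x | P (term_act t x)] wt q) ->
  degrees_in P wt (ore_mul (graded_data D) h q).
Proof.
move=> hqP; apply: degrees_in_sum => t; rewrite mcoeff_msupp => /hqP qP.
exact/degrees_inZ/degrees_in_graded_oreXn.
Qed.

End GradedDegrees.

(** * Comparison of the two products *)

Section TermOrder.

Variables (R : nzRingType) (n m : nat) (D : ore_data R n).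
Variables (lt : rel (mterm n m)).
Hypothesis lt_wo : well_ordering lt.
Hypothesis lt_act : forall w t1 t2,
  lt t1 t2 -> lt (term_act w t1) (term_act w t2).
Implicit Types (P Q : pred (mterm n m)) (wt d e : mterm n m).
Implicit Types (p q h : {mpoly R[n]}).

Definition below d : pred (mterm n m) := [pred x | lt x d].
Definition upto d : pred (mterm n m) := [pred x | (x == d) || lt x d].

Lemma below_upto d : {subset below d <= upto d}.
Proof. by move=> x; rewrite !inE orbC => ->. Qed.

Lemma upto_trans d e : d \in upto e -> {subset upto d <= upto e}.
Proof.
case: lt_wo => _ lt_trans _ _; rewrite !inE => /orP[/eqP -> //|de] x.
rewrite !inE => /orP[/eqP ->|xd]; first by rewrite de orbT.
by rewrite (lt_trans _ _ _ xd de) orbT.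
Qed.

Lemma below_trans d e : d \in upto e -> {subset below d <= below e}.
Proof.
case: lt_wo => _ lt_trans _ _; rewrite !inE => /orP[/eqP -> //|de] x.
by rewrite !inE => /lt_trans; apply.
Qed.

Lemma upto_below d e : d \in below e -> {subset upto d <= below e}.
Proof.
case: lt_wo => _ lt_trans _ _; rewrite !inE => de x.
by rewrite !inE => /orP[/eqP -> //|/lt_trans]; apply.
Qed.

Lemma upto_act t x d : x \in upto d -> term_act t x \in upto (term_act t d).
Proof. by rewrite !inE => /orP[/eqP -> |/lt_act ->]; rewrite ?eqxx ?orbT. Qed.

(* Otherwise d, t o d, t o (t o d), ... would be an infinite descent. *)
Lemma lt_term_act t d : t != 0%MM -> lt d (term_act t d).
Proof.
case: lt_wo => _ _ lt_total lt_wf t0.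
have neq_dt : d != term_act t d.
  apply: contraNneq t0 => /(congr1 fst) /= /eqP.
  by rewrite -{1}[d.1]add0m eqm_add2r eq_sym.
have /orP[//|ltd] := lt_total _ _ neq_dt.
suff [] : False.
elim/(well_founded_ind lt_wf): {neq_dt} d ltd => d IHd ltd.
exact: IHd ltd (lt_act t ltd).
Qed.

(** Passing from [t] to Y_i [t], the old discrepancy is shifted by Y_i or kept by [delta D i], and
    the new error is [delta D i] of the graded product. The latter has degrees up to t o d, which
    lies below Y_i o t o d by [lt_term_act]. *)
Lemma degrees_in_oreXn_graded wt d t q : degrees_in (upto d) wt q ->
  degrees_in (below (term_act t d)) wt
    (oreXn D t q - oreXn (graded_data D) t q).
Proof.
move=> qd; elim/mnm_ind: t => [|i t IHt].
  by rewrite !oreXn0l subrr; apply: degrees_in0.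
rewrite !oreXn_add !oreXnU; set p := oreXn D t q; set p' := oreXn _ t q.
have p'd : degrees_in (upto (term_act t d)) wt p'.
  apply: degrees_in_graded_oreXn.
  by apply: degrees_in_sub qd => x /(upto_act t).
have U_gt e : lt e (term_act U_(i)%MM e).
  by apply: lt_term_act; rewrite mnm1_eq0.
rewrite -{1}(subrK p' p) oreXD (oreX_graded D i p') addrA addrAC addrK.
rewrite term_actA; apply: degrees_inD; last first.
  by apply: degrees_in_map; apply: degrees_in_sub p'd; apply/upto_below/U_gt.
apply: degrees_inD.
  apply/degrees_inMX/degrees_in_map.
  by apply: degrees_in_sub IHt => x; exact: lt_act.
apply: degrees_in_map; apply: degrees_in_sub IHt; apply: below_trans.
by rewrite !inE U_gt orbT.
Qed.

Lemma degrees_in_mul_graded wt d e h q :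
  degrees_in (upto e) d h -> degrees_in (upto d) wt q ->
  degrees_in (below e) wt (ore_mul D h q - ore_mul (graded_data D) h q).
Proof.
move=> he qd; rewrite /ore_mul -sumrB; apply: degrees_in_sum => t.
rewrite mcoeff_msupp => /he te; rewrite -scalerBr; apply: degrees_inZ.
exact/degrees_in_sub/degrees_in_oreXn_graded/qd/below_trans.
Qed.

End TermOrder.

(** * Degrees of rows *)

Section Rows.

Variables (R : nzRingType) (n m k : nat).
Variable (W : 'I_k -> mterm n m).
Implicit Types (P Q : pred (mterm n m)) (d : mterm n m).
Implicit Types (f s : 'rV[{mpoly R[n]}]_k).

Definition vdegrees_in P s : Prop :=
  forall i, degrees_in P (W i) (s ord0 i).

Definition vcomponent d s : 'rV[{mpoly R[n]}]_k :=
  \row_i component d (W i) (s ord0 i).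

Lemma vdegrees_in_sub P Q s : {subset P <= Q} ->
  vdegrees_in P s -> vdegrees_in Q s.
Proof. by move=> sPQ sP i; apply/degrees_in_sub/sP. Qed.

Lemma vdegrees_in0 P : vdegrees_in P 0.
Proof. by move=> i; rewrite mxE; apply: degrees_in0. Qed.

Lemma vdegrees_inD P f s :
  vdegrees_in P f -> vdegrees_in P s -> vdegrees_in P (f + s).
Proof. by move=> fP sP i; rewrite mxE; apply: degrees_inD. Qed.

Lemma vdegrees_inB P f s :
  vdegrees_in P f -> vdegrees_in P s -> vdegrees_in P (f - s).
Proof. by move=> fP sP i; rewrite !mxE; apply: degrees_inB. Qed.

Lemma vdegrees_in_sum P (I : eqType) (r : seq I) (F : I -> 'rV[{mpoly R[n]}]_k) :
  (forall i, i \in r -> vdegrees_in P (F i)) ->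
  vdegrees_in P (\sum_(i <- r) F i).
Proof.
move=> FP; rewrite big_seq.
by elim/big_rec: _ => [|i p /FP]; [apply: vdegrees_in0 | apply: vdegrees_inD].
Qed.

Lemma vcomponentD d f s :
  vcomponent d (f + s) = vcomponent d f + vcomponent d s.
Proof.
apply/rowP=> i; rewrite !mxE; apply/mpolyP=> w.
by rewrite mcoeffD !mcoeff_component mcoeffD; case: ifP => _ //; rewrite addr0.
Qed.

Lemma vcomponentB d f s :
  vcomponent d (f - s) = vcomponent d f - vcomponent d s.
Proof.
apply/rowP=> i; rewrite !mxE; apply/mpolyP=> w.
by rewrite mcoeffB !mcoeff_component mcoeffB; case: ifP => _ //; rewrite subr0.
Qed.

Lemma vdegrees_in_component d s : vdegrees_in (pred1 d) (vcomponent d s).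
Proof.
move=> i w; rewrite mxE mcoeff_component /=.
by case: ifP => // _; rewrite eqxx.
Qed.

Lemma vcomponent_id d s : vdegrees_in (pred1 d) s -> vcomponent d s = s.
Proof.
move=> sd; apply/rowP=> i; rewrite mxE; apply/mpolyP=> w.
rewrite mcoeff_component; case: ifP => // wd.
by apply/esym/eqP; apply: contraFT wd => /(sd i w).
Qed.

Lemma vcomponent_out P d s : ~~ P d -> vdegrees_in P s -> vcomponent d s = 0.
Proof.
move=> Pd sP; apply/rowP=> i; rewrite !mxE; apply/mpolyP=> w.
rewrite mcoeff_component mcoeff0; case: eqP => // wd.
by apply/eqP; apply: contraNT Pd => /(sP i w); rewrite wd.
Qed.

Lemma vneq0P s : reflect (exists i w, (s ord0 i)@_w != 0) (s != 0).
Proof.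
apply: (iffP idP) => [s0|[i [w siw]]]; last first.
  by apply: contraNneq siw => ->; rewrite mxE mcoeff0.
case/rV0Pn: s0 => i; rewrite -msupp_eq0; case supE: (msupp _) => [|w r] // _.
by exists i, w; rewrite -mcoeff_msupp supE mem_head.
Qed.

End Rows.

Arguments vdegrees_in_component {R n m k} W d s.

(** * Left linear combinations *)

Section MapSum.

Variables (R : nzRingType) (n k l : nat) (E : ore_data R n).
Variable G : 'I_k -> 'rV[{mpoly R[n]}]_l.
Implicit Types s : 'rV[{mpoly R[n]}]_k.

(** Covers both syzygy maps: S_L for [D] and the g_i, s_L for [graded_data D] and the M(g_i). Rows
    over [{mpoly R[n]}] let elements of the two extensions be subtracted from each other. *)
Definition comb s : 'rV[{mpoly R[n]}]_l :=
  \row_j \sum_i ore_mul E (s ord0 i) (G i ord0 j).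

Lemma combD s1 s2 : comb (s1 + s2) = comb s1 + comb s2.
Proof.
apply/rowP=> j; rewrite !mxE -big_split; apply: eq_bigr => i _.
by rewrite mxE ore_mulDl.
Qed.

Lemma comb0 : comb 0 = 0.
Proof. by apply: (addIr (comb 0)); rewrite -combD !add0r. Qed.

Lemma combB s1 s2 : comb (s1 - s2) = comb s1 - comb s2.
Proof. by apply/eqP; rewrite eq_sym subr_eq -combD subrK. Qed.

Lemma comb_sum (I : Type) (r : seq I) (F : I -> 'rV[{mpoly R[n]}]_k) :
  comb (\sum_(i <- r) F i) = \sum_(i <- r) comb (F i).
Proof. exact: (big_morph _ combD comb0). Qed.

Definition lmul h s : 'rV[{mpoly R[n]}]_k := \row_i ore_mul E h (s ord0 i).

Lemma lmulDl h1 h2 s : lmul (h1 + h2) s = lmul h1 s + lmul h2 s.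
Proof. by apply/rowP=> i; rewrite !mxE ore_mulDl. Qed.

Lemma lmulDr h s1 s2 : lmul h (s1 + s2) = lmul h s1 + lmul h s2.
Proof. by apply/rowP=> i; rewrite !mxE ore_mulDr. Qed.

Lemma lmul0r h : lmul h 0 = 0.
Proof. by apply: (addIr (lmul h 0)); rewrite -lmulDr !add0r. Qed.

Definition single i h : 'rV[{mpoly R[n]}]_k := \row_j (if j == i then h else 0).

Lemma ore_mul0l (q : {mpoly R[n]}) : ore_mul E 0 q = 0.
Proof. by rewrite ore_mulE lin_ext0. Qed.

End MapSum.

Section CombTheory.

Variables (R : nzRingType) (n k l : nat) (E : ore_data R n).
Variable G : 'I_k -> 'rV[{mpoly R[n]}]_l.

Lemma comb_lmul h s : comb E G (lmul E h s) = lmul E h (comb E G s).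
Proof.
apply/rowP=> j; rewrite !mxE.
rewrite (big_morph _ (ore_mulDr E h) (_ : ore_mul E h 0 = 0)).
  by apply: eq_bigr => i _; rewrite mxE ore_mulA.
by apply: (addIr (ore_mul E h 0)); rewrite -ore_mulDr !add0r.
Qed.

Lemma comb_single i h : comb E G (single i h) = lmul E h (G i).
Proof.
apply/rowP=> j; rewrite !mxE (bigD1 i) //= mxE eqxx.
rewrite big1 ?addr0 // => i' /negbTE i'i.
by rewrite mxE i'i ore_mul0l.
Qed.

End CombTheory.

(** * Leading terms and leading forms *)

Section Leading.

Variables (R : nzRingType) (n m : nat) (D : ore_data R n).
Variables (prec : rel 'X_{1..n}) (lt : rel (mterm n m)).
Hypothesis prec_wo : well_ordering prec.
Hypothesis lt_wo : well_ordering lt.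
Hypothesis prec_act : forall w1 w2 t,
  prec w1 w2 -> lt (term_act w1 t) (term_act w2 t).
Hypothesis lt_act : forall w t1 t2,
  lt t1 t2 -> lt (term_act w t1) (term_act w t2).
Implicit Types (P Q : pred (mterm n m)) (wt d e : mterm n m).
Implicit Types (h q : {mpoly R[n]}).

(** The weight of the i-th coordinate of R^m, for which the degrees of an element are its own
    terms. *)
Definition unit_term (i : 'I_m.+1) : mterm n m := (0%MM, i).

Lemma term_act_unit t i : term_act t (unit_term i) = (t, i).
Proof. by rewrite /term_act /= addm0. Qed.

Lemma ltxx d : lt d d = false.
Proof. by case: lt_wo => ->. Qed.

Lemma vcomponent_below k (W : 'I_k -> mterm n m) d (s : 'rV[{mpoly R[n]}]_k) :
  vdegrees_in W (below lt d) s -> vcomponent W d s = 0.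
Proof. by apply: vcomponent_out; apply: (negbT (ltxx d)). Qed.

Lemma vdegrees_in_subcomponent k (W : 'I_k -> mterm n m) d
    (s : 'rV[{mpoly R[n]}]_k) :
  vdegrees_in W (upto lt d) s ->
  vdegrees_in W (below lt d) (s - vcomponent W d s).
Proof.
move=> sd i w; rewrite !mxE mcoeffB mcoeff_component.
case: ifP => [_|nwd]; first by rewrite subrr eqxx.
by rewrite subr0 => /(sd i w); rewrite /upto /= nwd.
Qed.

Lemma lead_term_max h w : h@_w != 0 ->
  h@_(lead_term prec h) != 0 /\
  (w = lead_term prec h \/ prec w (lead_term prec h)).
Proof.
rewrite -!mcoeff_msupp => hw; have h0 : msupp h != [::] by case: msupp hw.
by have [? max] := max_ofP 0%MM prec_wo h0; split; last exact: max.
Qed.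

Lemma lead_term_upto h w wt : h@_w != 0 ->
  term_act w wt \in upto lt (term_act (lead_term prec h) wt).
Proof.
by case/lead_term_max=> _ [-> | /prec_act w_lt]; rewrite !inE ?eqxx ?w_lt ?orbT.
Qed.

Lemma lead_termP P wt h :
  h != 0 -> degrees_in P wt h -> P (term_act (lead_term prec h) wt).
Proof.
rewrite -msupp_eq0; case supE: (msupp h) => [|w r] // _; apply.
by have [] := @lead_term_max h w; rewrite // -mcoeff_msupp supE mem_head.
Qed.

Lemma degrees_in_lead P wt h : (forall d e, d \in upto lt e -> P e -> P d) ->
  (h != 0 -> P (term_act (lead_term prec h) wt)) -> degrees_in P wt h.
Proof.
move=> Pdown hP w hw; apply: (Pdown _ _ (lead_term_upto wt hw)).
by apply: hP; apply: contraNneq hw => ->; rewrite mcoeff0.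
Qed.

Lemma vlead_termP (f : 'rV[{mpoly R[n]}]_m.+1) : f != 0 ->
  vlead_coef lt f != 0 /\ vdegrees_in unit_term (upto lt (vlead_term lt f)) f.
Proof.
case/vneq0P=> i [w fiw].
have vsuppE j t : ((t, j) \in vsupp f) = ((f ord0 j)@_t != 0).
  rewrite -mcoeff_msupp; apply/allpairsPdep/idP => [[j' [t' [_ tj [-> ->]]]] //|tj].
  by exists j, t; rewrite mem_enum.
have f0 : vsupp f != [::] by have := vsuppE i w; rewrite fiw; case: vsupp.
have [] := max_ofP (0%MM, ord0) lt_wo f0.
rewrite -/(vlead_term lt f) => fT Tmax.
split; first by rewrite /vlead_coef -vsuppE -surjective_pairing.
move=> j t; rewrite -vsuppE term_act_unit /upto /= => /Tmax.
by case=> ->; rewrite ?eqxx ?orbT.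
Qed.

Lemma vlead_term_in P (f : 'rV[{mpoly R[n]}]_m.+1) : f != 0 ->
  vdegrees_in unit_term P f -> P (vlead_term lt f).
Proof.
move=> /vlead_termP[c0 _] /(_ _ _ c0).
by rewrite term_act_unit -surjective_pairing.
Qed.

Lemma vlead_monomE (f : 'rV[{mpoly R[n]}]_m.+1) :
  vlead_monom lt f = vcomponent unit_term (vlead_term lt f) f.
Proof.
apply/rowP=> j; rewrite !mxE /vlead_coef; apply/mpolyP=> w.
rewrite mcoeff_component term_act_unit; case: (vlead_term lt f) => t i /=.
rewrite xpair_eqE andbC; case: eqP => [-> /=|_]; last by rewrite mcoeff0.
by rewrite mcoeffZ mcoeffX (eq_sym t); case: eqP => [-> |_]; rewrite ?mulr1 ?mulr0.
Qed.

Variables (u : nat) (g : 'I_u -> 'rV[{mpoly R[n]}]_m.+1).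
Hypothesis g_neq0 : forall i, g i != 0.
Implicit Types s U : 'rV[{mpoly R[n]}]_u.

Local Notation W := (fun i => vlead_term lt (g i)).
Local Notation lm := (fun i => vlead_monom lt (g i)).

Lemma syz_degreeP s : s != 0 ->
  vdegrees_in W (upto lt (syz_degree prec lt g s)) s /\
  (forall P, vdegrees_in W P s -> P (syz_degree prec lt g s)).
Proof.
move=> s0; pose r := [seq term_act (lead_term prec (s ord0 i)) (W i)
       | i <- enum 'I_u & s ord0 i != 0].
have rP i : s ord0 i != 0 -> term_act (lead_term prec (s ord0 i)) (W i) \in r.
  move=> si; apply: (map_f (fun i => term_act _ (W i))).
  by rewrite mem_filter si mem_enum.
have r0 : r != [::] by case/rV0Pn: s0 => i /rP; case: r {rP}.
have [] := max_ofP (0%MM, ord0) lt_wo r0.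
rewrite -/(syz_degree prec lt g s) => rT Tmax.
split=> [i w siw | P sP]; last first.
  by case/mapP: rT => i; rewrite mem_filter => /andP[si _] ->; exact: lead_termP.
have si : s ord0 i != 0 by apply: contraNneq siw => ->; rewrite mcoeff0.
apply: (upto_trans lt_wo _ (lead_term_upto (W i) siw)).
by case: (Tmax _ (rP i si)) => H; rewrite !inE -?H ?eqxx ?H ?orbT.
Qed.

(** All degrees of [s] are at most v(s), so a term of degree v(s) in a coordinate must be the
    leading term of that coordinate. *)
Lemma lead_formE s :
  lead_form prec lt g s = vcomponent W (syz_degree prec lt g s) s.
Proof.
have [->|s0] := eqVneq s 0.
  apply/rowP=> i; rewrite !mxE eqxx /=; apply/mpolyP=> w.
  by rewrite mcoeff_component !mcoeff0 if_same.
have [sT _] := syz_degreeP s0; set d := syz_degree _ _ _ _ in sT *.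
apply/rowP=> i; rewrite !mxE -/d; apply/mpolyP=> w.
rewrite mcoeff_component /lead_monom; set h := s ord0 i.
have act_inj a b : term_act a (W i) = term_act b (W i) -> a = b.
  by move=> /(congr1 fst) /= /eqP; rewrite eqm_add2r => /eqP.
case: ifP => [/andP[h0 /eqP td]|ntd].
  rewrite mcoeffZ mcoeffX -td (inj_eq act_inj) eq_sym.
  by case: eqP => [->|_]; rewrite ?mulr1 ?mulr0.
rewrite mcoeff0; case: eqP => // wd; apply/esym/eqP; apply: contraFT ntd => hw.
have h0 : h != 0 by apply: contraNneq hw => ->; rewrite mcoeff0.
rewrite h0 /=; have /= := lead_termP h0 (sT i).
case/orP => // hd.
have := lead_term_upto (W i) hw; rewrite wd => /(below_trans lt_wo).
by move=> /(_ _ hd); rewrite !inE ltxx.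
Qed.

Lemma homogeneousP s :
  homogeneous lt g s <-> s != 0 /\ exists d, vdegrees_in W (pred1 d) s.
Proof.
split=> [[s0 [a [t [d [sE tE]]]]] | [s0 [d sd]]]; split=> //.
  exists d => i w; rewrite sE mcoeffZ mcoeffX; case: (eqVneq (t i) w) => [<-|_].
    by rewrite mulr1 => /tE -> /=.
  by rewrite mulr0 eqxx.
(* The only exponent that can have degree [d] at index [i]; [a i] is set to 0 when the truncated
   subtraction misses [d]. *)
pose t i := (d.1 - (W i).1)%MM.
pose a i := if term_act (t i) (W i) == d then (s ord0 i)@_(t i) else 0.
exists a, t, d; rewrite /a.
split=> i; last by case: ifP => [/eqP|]; rewrite ?eqxx.
rewrite -{1}(vcomponent_id sd) mxE /component -/(t i).
by case: ifP; rewrite ?scale0r.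
Qed.

Lemma syz_degree_homogeneous d s : s != 0 -> vdegrees_in W (pred1 d) s ->
  syz_degree prec lt g s = d.
Proof. by move=> /syz_degreeP[_ sP] /sP /eqP. Qed.

(** Replaces the leading form, which is not additive, by a condition on [U - s] that survives sums
    and differences. *)
Lemma lead_form_homogeneousP d s U : s != 0 -> vdegrees_in W (pred1 d) s ->
  U != 0 /\ lead_form prec lt g U = s <-> vdegrees_in W (below lt d) (U - s).
Proof.
move=> s0 sd; rewrite lead_formE; split=> [[U0 Us] | Usd].
  have [UT _] := syz_degreeP U0; set e := syz_degree _ _ _ _ in Us UT.
  have se : vdegrees_in W (pred1 e) s by rewrite -Us; exact: vdegrees_in_component.
  have de : e = d.
    by rewrite -(syz_degree_homogeneous s0 sd) (syz_degree_homogeneous s0 se).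
  by rewrite -de -Us; exact: vdegrees_in_subcomponent.
have Ud : vcomponent W d U = s.
  have := vcomponent_below Usd.
  by rewrite vcomponentB (vcomponent_id sd) => /eqP; rewrite subr_eq0 => /eqP.
have U0 : U != 0.
  apply: contraNneq s0 => U0; rewrite -Ud U0.
  by apply/eqP/(@vcomponent_out _ _ _ _ _ pred0) => //; exact: vdegrees_in0.
split=> //; have [UT UP] := syz_degreeP U0.
set e := syz_degree _ _ _ _ in UT UP *.
(* v(U) is at most [d]; were it smaller, the degree [d] part of [U], which is [s], would vanish. *)
suff -> : e = d by [].
have /orP[/eqP // | ed] : upto lt d e.
  apply: UP; rewrite -[U](subrK s); apply: vdegrees_inD.
    exact/vdegrees_in_sub/Usd/below_upto.
  by apply: vdegrees_in_sub sd => x; rewrite !inE => ->.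
case/eqP: s0; rewrite -Ud; apply: vcomponent_below.
exact/vdegrees_in_sub/UT/upto_below.
Qed.

(** * Comparison of the two syzygy maps *)

Local Notation Gr := (graded_data D).

Lemma comb_lead_monom_degrees P s :
  vdegrees_in W P s ->
  vdegrees_in unit_term P (comb Gr lm s).
Proof.
move=> sP j; rewrite mxE; apply: degrees_in_sum => i _.
apply: degrees_in_graded_mul => t /(sP i) Pt.
have /(_ j) := vdegrees_in_component unit_term (vlead_term lt (g i)) (g i).
rewrite -vlead_monomE; apply: degrees_in_sub => x.
by rewrite !inE => /eqP ->.
Qed.

(** Two errors occur for each [i]: replacing the Ore product by the graded one, and replacing g_i by
    M(g_i), whose difference lies below T(g_i). *)
Lemma comb_graded d s : vdegrees_in W (upto lt d) s ->
  vdegrees_in unit_term (below lt d) (comb D g s - comb Gr lm s).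
Proof.
move=> sd j; rewrite !mxE -sumrB; apply: degrees_in_sum => i _.
have [_ giT] := vlead_termP (g_neq0 i).
set a := s ord0 i; set b := g i ord0 j; set c := lm i ord0 j.
rewrite -(subrK (ore_mul Gr a b) (ore_mul D a b)) -addrA; apply: degrees_inD.
  exact: degrees_in_mul_graded (sd i) (giT j).
rewrite -{1}(subrK c b) ore_mulDr addrK.
apply: degrees_in_graded_mul => t /(sd i) td.
have /(_ j) := vdegrees_in_subcomponent giT.
rewrite -vlead_monomE mxE [X in _ + X]mxE.
by apply: degrees_in_sub => x /(lt_act t); apply: below_trans td _.
Qed.

Lemma comb_upto d s : vdegrees_in W (upto lt d) s ->
  vdegrees_in unit_term (upto lt d) (comb D g s).
Proof.
move=> sd; rewrite -(subrK (comb Gr lm s) (comb D g s)); apply: vdegrees_inD.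
  exact/vdegrees_in_sub/comb_graded/sd/below_upto.
exact: comb_lead_monom_degrees.
Qed.

Lemma pred1_upto d : {subset pred1 d <= upto lt d}.
Proof. by move=> x; rewrite !inE => ->. Qed.

(* The graded combination of the leading monomials is encoded by a row h of *)
(* monomials, instead of a sequence of triples as in left_groebner_basis. *)
Definition weak_groebner := forall s, comb D g s != 0 ->
  let f := comb D g s in exists2 h, vdegrees_in W (pred1 (vlead_term lt f)) h
    & comb Gr lm h = vlead_monom lt f.

(** The row 0 is allowed for [s] and [U], so that liftable rows of a fixed degree are closed under
    addition. *)
Definition liftable d s :=
  exists2 U, comb D g U = 0 & vdegrees_in W (below lt d) (U - s).

Lemma groebner_representation s : weak_groebner -> comb D g s != 0 ->
  exists2 l, comb D g s = comb D g l &
    vdegrees_in W (upto lt (vlead_term lt (comb D g s))) l.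
Proof.
move=> gb; have [_ _ _ lt_wf] := lt_wo.
move dE: (vlead_term _ _) => d.
elim/(well_founded_ind lt_wf): d s dE => d IHd s dE s0.
have [_ sd] := vlead_termP s0; rewrite dE in sd.
have [h hd hE] := gb s s0; rewrite dE in hd.
have below_d : vdegrees_in unit_term (below lt d) (comb D g (s - h)).
  rewrite combB -(subrK (comb Gr lm h) (comb D g s)) -addrA.
  apply: vdegrees_inD.
    by rewrite hE vlead_monomE dE; apply: vdegrees_in_subcomponent.
  rewrite -[X in vdegrees_in _ _ X]opprK opprB -[- _]sub0r.
  apply: vdegrees_inB; first exact: vdegrees_in0.
  by apply: comb_graded; apply: vdegrees_in_sub hd; exact: pred1_upto.
have [sh0|sh0] := eqVneq (comb D g (s - h)) 0.
  exists h; last by apply: vdegrees_in_sub hd; exact: pred1_upto.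
  by apply/eqP; rewrite -subr_eq0 -combB sh0.
have ed := vlead_term_in sh0 below_d.
have [l lE ld] := IHd _ ed _ erefl sh0.
exists (h + l); first by rewrite combD -lE -combD addrC subrK.
apply: vdegrees_inD; first by apply: vdegrees_in_sub hd; exact: pred1_upto.
by apply: vdegrees_in_sub ld; apply: upto_trans => //; exact: below_upto.
Qed.

(** Well-founded induction on a bound [d] for the degrees of a representation of the fixed [f]. If
    [d] is T(f), the degree [d] part of the representation yields M(f); otherwise that part is a
    syzygy. *)
Lemma weak_groebner_of_lifting :
  (forall d s, s != 0 -> vdegrees_in W (pred1 d) s -> comb Gr lm s = 0 ->
    liftable d s) ->
  weak_groebner.
Proof.
move=> lift s0; have [_ _ _ lt_wf] := lt_wo; move fE: (comb D g s0) => f f0 /=.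
have s00 : s0 != 0 by apply: contraNneq f0 => s00; rewrite -fE s00 comb0.
have [s0d _] := syz_degreeP s00; move: (syz_degree _ _ _ _) s0d fE => d {s00}.
elim/(well_founded_ind lt_wf): d s0 => d IHd s sd fE.
have fd : vdegrees_in unit_term (upto lt d) f by rewrite -fE; exact: comb_upto.
pose h := vcomponent W d s.
have hd : vdegrees_in W (pred1 d) h by exact: vdegrees_in_component.
have shd : vdegrees_in W (below lt d) (s - h).
  exact: vdegrees_in_subcomponent.
have fhd : vdegrees_in unit_term (below lt d) (f - comb Gr lm h).
  rewrite -(subrK (comb Gr lm s) f) -addrA -combB; apply: vdegrees_inD.
    by rewrite -fE; exact: comb_graded.
  exact: comb_lead_monom_degrees.
have hdE : comb Gr lm h = vcomponent unit_term d f.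
  have := vcomponent_below fhd; rewrite vcomponentB => /eqP.
  rewrite subr_eq0 => /eqP ->; rewrite vcomponent_id //.
  exact: comb_lead_monom_degrees.
have /orP[/eqP dE | ltd] := vlead_term_in f0 fd.
  by exists h; rewrite ?vlead_monomE dE.
(* Here T(f) lies below [d], so [f] has no part of degree [d]. *)
have h0 : comb Gr lm h = 0.
  rewrite hdE; apply: vcomponent_below; have [_ fT] := vlead_termP f0.
  exact/vdegrees_in_sub/fT/upto_below.
have [V V0 Vd] : liftable d h.
  have [->|hn0] := eqVneq h 0; last exact: lift.
  by exists 0; rewrite ?comb0 ?subr0 //; exact: vdegrees_in0.
have sVd : vdegrees_in W (below lt d) (s - V).
  have -> : s - V = (s - h) - (V - h) by rewrite opprB addrA subrK.
  exact: vdegrees_inB.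
have sVE : comb D g (s - V) = f by rewrite combB V0 subr0.
have sV0 : s - V != 0 by apply: contraNneq f0 => sV0; rewrite -sVE sV0 comb0.
have [sVe sVP] := syz_degreeP sV0.
exact: IHd (sVP _ sVd) _ sVe sVE.
Qed.

(** Graded products add degrees exactly, so only the part [h'] of [h] that carries degree [e] to [d]
    contributes in degree [d]. The lifting is the Ore product of [h'] and [U]. *)
Lemma liftable_lmul d e h s U : vdegrees_in W (pred1 e) s -> comb D g U = 0 ->
  vdegrees_in W (below lt e) (U - s) ->
  liftable d (vcomponent W d (lmul Gr h s)).
Proof.
move=> se U0 Use; pose h' := component d e h.
have h'd : degrees_in (pred1 d) e h'.
  by move=> t; rewrite mcoeff_component /=; case: ifP; rewrite ?eqxx.
have hh'd : degrees_in (predC1 d) e (h - h').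
  move=> t; rewrite mcoeffB mcoeff_component /=.
  by case: (term_act t e =P d) => // _; rewrite subrr eqxx.
have exact_mul Q q : degrees_in Q e q -> vdegrees_in W Q (lmul Gr q s).
  move=> qQ i; rewrite mxE; apply: degrees_in_graded_mul => t /qQ te.
  by apply: degrees_in_sub (se i) => x; rewrite !inE => /eqP ->.
have compE : vcomponent W d (lmul Gr h s) = lmul Gr h' s.
  rewrite -{1}(subrK h' h) lmulDl vcomponentD (vcomponent_out (P := predC1 d)).
  - by rewrite add0r vcomponent_id //; exact: exact_mul.
  - by rewrite /= eqxx.
  exact: exact_mul.
rewrite compE; exists (lmul D h' U); first by rewrite comb_lmul U0 lmul0r.
rewrite -(subrK (lmul Gr h' U) (lmul D h' U)) -addrA; apply: vdegrees_inD.
  have Ue : vdegrees_in W (upto lt e) U.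
    rewrite -(subrK s U); apply: vdegrees_inD.
      by apply: vdegrees_in_sub Use; exact: below_upto.
    by apply: vdegrees_in_sub se; exact: pred1_upto.
  move=> i; rewrite !mxE; apply: degrees_in_mul_graded (Ue i) => //.
  by apply: degrees_in_sub h'd; exact: pred1_upto.
rewrite -{1}(subrK s U) lmulDr addrK => i; rewrite mxE.
apply: degrees_in_graded_mul => t /h'd /eqP <-.
by apply: degrees_in_sub (Use i) => x; exact: lt_act.
Qed.

Lemma liftable_span d (r : seq ({mpoly R[n]} * 'rV[{mpoly R[n]}]_u)) :
  (forall p, p \in r ->
    exists2 e, vdegrees_in W (pred1 e) p.2 & liftable e p.2) ->
  liftable d (vcomponent W d (\sum_(p <- r) lmul Gr p.1 p.2)).
Proof.
elim: r => [|p r IHr] rP.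
  exists 0; first exact: comb0.
  rewrite big_nil sub0r -[- _]sub0r.
  apply: vdegrees_inB; first exact: vdegrees_in0.
  by rewrite (@vcomponent_out _ _ _ _ _ pred0) => //; exact: vdegrees_in0.
have [e pe [U U0 Upe]] := rP p (mem_head _ _).
have [V V0 Vd] := liftable_lmul d p.1 pe U0 Upe.
have [V' V'0 V'd] : liftable d (vcomponent W d (\sum_(p <- r) lmul Gr p.1 p.2)).
  by apply: IHr => q qr; apply: rP; rewrite inE qr orbT.
exists (V + V'); first by rewrite combD V0 V'0 addr0.
by rewrite big_cons vcomponentD opprD addrACA; apply: vdegrees_inD.
Qed.

End Leading.

(** * The conditions of the theorem in terms of degrees *)

Section Reformulations.

Variables (R : nzRingType) (n m u : nat) (D : ore_data R n).
Variables (prec : rel 'X_{1..n}) (lt : rel (mterm n m)).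
Variable g : 'I_u -> 'rV[ore D]_m.+1.
Local Notation gb := (g : 'I_u -> 'rV[{mpoly R[n]}]_m.+1).
Local Notation lm := (fun i => vlead_monom lt (gb i)).
Local Notation W := (fun i => vlead_term lt (gb i)).

Lemma syz_mapE (s : 'rV[ore D]_u) : syz_map g s = comb D gb s.
Proof.
apply/rowP=> j; rewrite [LHS]summxE [RHS]mxE.
by apply: eq_bigr => i _; rewrite mxE.
Qed.

Lemma graded_syz_mapE (s : 'rV[gore D]_u) :
  graded_syz_map lt g s = comb (graded_data D) lm s.
Proof.
apply/rowP=> j; rewrite [LHS]summxE [RHS]mxE.
by apply: eq_bigr => i _; rewrite mxE.
Qed.

Lemma scale_lmul (E : ore_data R n) k (h : ore E) (s : 'rV[ore E]_k) :
  h *: s = lmul E h s.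
Proof. by apply/rowP=> j; rewrite [LHS]mxE [RHS]mxE. Qed.

Lemma sum_scale_lmul (E : ore_data R n) k (I : Type) (r : seq I)
    (h : I -> ore E) (s : I -> 'rV[ore E]_k) :
  \sum_(i <- r) h i *: s i =
  (\sum_(i <- r) lmul E (h i) (s i) : 'rV[{mpoly R[n]}]_k).
Proof.
elim: r => [|i r IHr]; first by rewrite [LHS]big_nil [RHS]big_nil.
by rewrite [LHS]big_cons [RHS]big_cons IHr scale_lmul.
Qed.

Lemma in_left_moduleP (f : 'rV[ore D]_m.+1) :
  in_left_module g f <-> exists s, f = comb D gb s.
Proof.
split=> [[r [rg ->]] | [s ->]]; last first.
  exists [seq (s ord0 i, g i) | i <- enum 'I_u]; split.
    by move=> p /mapP[i _ ->]; exists i.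
  by rewrite -[LHS](syz_mapE s) big_map big_enum.
rewrite sum_scale_lmul; elim: r rg => [|p r IHr] rg.
  by exists 0; rewrite big_nil comb0.
have [i pE] := rg p (mem_head _ _); have [|s sE] := IHr.
  by move=> q qr; apply: rg; rewrite inE qr orbT.
exists (single i p.1 + s); rewrite big_cons [X in _ + X]sE combD; congr (_ + _).
by rewrite comb_single pE.
Qed.

Lemma left_groebner_basisP :
  left_groebner_basis lt g <-> weak_groebner D lt gb.
Proof.
split=> [gbasis s f0 f | wgb f /in_left_moduleP[s ->] f0].
  have [|r [rP rE]] := gbasis f _ f0; first by apply/in_left_moduleP; exists s.
  (* Triples with the same index are merged into one coordinate. *)
  exists (\sum_(p <- r) single p.2 (p.1.1 *: 'X_[p.1.2])).
    apply: vdegrees_in_sum => p /rP[_ pf] i w; rewrite mxE.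
    case: (i =P p.2) => [->|_]; last by rewrite mcoeff0 eqxx.
    rewrite mcoeffZ mcoeffX; case: (p.1.2 =P w) => [<- _|_].
      by rewrite inE -pf.
    by rewrite mulr0 eqxx.
  rewrite comb_sum [RHS]rE sum_scale_lmul; apply: eq_bigr => p _.
  exact: comb_single.
have [h hT hE] := wgb s f0; set d := vlead_term _ _ in hT.
pose t i := (d.1 - (W i).1)%MM; pose a i := (h ord0 i)@_(t i).
have hX i : h ord0 i = a i *: 'X_[t i].
  rewrite -{1}(vcomponent_id hT) mxE /component -/(t i) -/(a i).
  case: ifP => // /negbT td.
  have [->|/(hT i)] := eqVneq (a i) 0; first by rewrite scale0r.
  by rewrite /= (negbTE td).
exists [seq (a i, t i, i) | i <- enum 'I_u & a i != 0]; split.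
  move=> p /mapP[i]; rewrite mem_filter => /andP[ai _] -> /=.
  by split=> //; apply/eqP/(hT i).
rewrite -hE -[LHS]graded_syz_mapE big_map big_filter big_enum_cond /=.
rewrite [RHS]big_mkcond; apply: eq_bigr => i _ /=; rewrite hX.
by have [->|//] := eqVneq; rewrite scale0r [LHS]scale0r.
Qed.

Hypothesis prec_wo : well_ordering prec.
Hypothesis lt_wo : well_ordering lt.
Hypothesis prec_act : forall w1 w2 t,
  prec w1 w2 -> lt (term_act w1 t) (term_act w2 t).

Lemma sum_mapE (E : ore_data R n) k (G : 'I_u -> 'rV[ore E]_k)
    (l : 'I_u -> ore E) :
  \sum_i l i *: G i = comb E G (\row_i l i).
Proof.
apply/rowP=> j; rewrite [LHS]summxE [RHS]mxE.
by apply: eq_bigr => i _; rewrite !mxE.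
Qed.

(** For a downward closed [P], testing the leading term of each coefficient tests all its terms. *)
Lemma vdegrees_in_lead (P : pred (mterm n m)) (l : 'I_u -> {mpoly R[n]}) :
  (forall d e, d \in upto lt e -> P e -> P d) ->
  vdegrees_in W P (\row_i l i) <->
  (forall i, l i != 0 -> P (term_act (lead_term prec (l i)) (W i))).
Proof.
move=> Pdown; split=> [lP i li | lP i]; last first.
  by rewrite mxE; exact: degrees_in_lead Pdown (lP i).
by apply: lead_termP => //; have := lP i; rewrite mxE.
Qed.

Lemma left_groebner_representationP (f : 'rV[ore D]_m.+1) :
  left_groebner_representation prec lt g f <->
  exists2 l, f = comb D gb l & vdegrees_in W (upto lt (vlead_term lt f)) l.
Proof.

split=> [[l [fE lP]] | [l fE lP]].
  exists (\row_i l i); first by rewrite fE sum_mapE.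
  apply/vdegrees_in_lead => [d e de ef | i /lP /= [->|lt_i]].
  - exact: (upto_trans lt_wo ef).
  - by rewrite /upto /= eqxx.
  by rewrite /upto /= lt_i orbT.
exists (fun i => l ord0 i); split; first by rewrite fE -[LHS](syz_mapE l).
move=> i li t; have /orP[/eqP|] := lead_termP prec_wo li (lP i); by [left | right].
Qed.

Lemma quasi_groebner_representationP (s : 'rV[gore D]_u) :
  quasi_groebner_representation prec lt g s <->
  exists2 l, comb D gb s = comb D gb l &
    vdegrees_in W (below lt (syz_degree prec lt gb s)) l.
Proof.
split=> [[l [sE lP]] | [l sE lP]].
  exists (\row_i l i); first by rewrite -[LHS](syz_mapE s) sE sum_mapE.
  by apply/vdegrees_in_lead => [d e de ef | //]; exact: (upto_below lt_wo ef).
exists (fun i => l ord0 i); split; first by rewrite [LHS]syz_mapE sE -[LHS]syz_mapE.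
by move=> i li; exact: (lead_termP prec_wo li (lP i)).
Qed.

Lemma has_liftingP d (s : 'rV[gore D]_u) :
  s != 0 -> vdegrees_in W (pred1 d) s ->
  has_lifting prec lt g s <-> liftable D lt gb d s.
Proof.
move=> s0 sd; have liftP U := lead_form_homogeneousP prec_wo lt_wo prec_act U s0 sd.
split=> [[U [U0 gU Us]] | [U gU /liftP[U0 Us]]]; exists U => //.
- by rewrite -[LHS]syz_mapE.
- exact/liftP.
by split=> //; rewrite [LHS]syz_mapE.
Qed.

End Reformulations.

(** * The cycle of implications *)

Theorem theorem33 (R : nzRingType) (n m u : nat) (D : ore_data R n)
    (prec : rel 'X_{1..n}) (lt : rel (mterm n m))
    (g : 'I_u -> 'rV[ore D]_m.+1) (GM : 'rV[gore D]_u -> Prop) :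
  GRing.integral_domain_axiom R ->
  term_ordering prec ->
  compatible_term_ordering prec lt ->
  (forall i, g i != 0) ->
  gebauer_moeller_set lt g GM ->
  [<-> left_groebner_basis lt g;
       forall f : 'rV[ore D]_m.+1, f != 0 ->
         (in_left_module g f <-> left_groebner_representation prec lt g f);
       forall s, GM s -> quasi_groebner_representation prec lt g s;
       forall s, GM s -> has_lifting prec lt g s;
       forall s : 'rV[gore D]_u, homogeneous lt g s -> graded_syz_map lt g s = 0 ->
         has_lifting prec lt g s].
Proof.
move=> _ [prec_wo _] [lt_wo prec_act lt_act] g0 [GMker GMspan].
have GMhom s : GM s -> [/\ s != 0,
    comb (graded_data D) (fun i => vlead_monom lt (g i)) s = 0
    & exists d, vdegrees_in (fun i => vlead_term lt (g i)) (pred1 d) s].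
  by case/GMker=> /homogeneousP[s0 sd]; rewrite graded_syz_mapE.
tfae.
- move=> /left_groebner_basisP gb f f0; split=> [/in_left_moduleP[s fE] | [l [-> _]]].
    apply/left_groebner_representationP => //; rewrite fE in f0 *.
    exact: groebner_representation.
  by apply/in_left_moduleP; exists (\row_i l i); rewrite sum_mapE.
- move=> gr s /GMhom[s0 sker [d sd]]; apply/quasi_groebner_representationP => //.
  rewrite (syz_degree_homogeneous _ _ _ s0 sd) //.
  have below_d : vdegrees_in (@unit_term n m) (below lt d) (comb D g s).
    rewrite -[comb D g s]subr0 -sker; apply: comb_graded => //.
    by apply: vdegrees_in_sub sd; exact: pred1_upto.
  (* Condition (2) concerns nonzero elements only; a vanishing S-polynomial is represented by the
     zero row. *)
  have [f0|f0] := eqVneq (comb D g s) 0.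
    by exists 0; [rewrite f0 comb0 | exact: vdegrees_in0].
  have [|l fE lP] :=
      (left_groebner_representationP g prec_wo lt_wo prec_act (comb D g s)).1.
    by apply/gr => //; apply/in_left_moduleP; exists s.
  exists l => //; apply: vdegrees_in_sub lP; apply: upto_below => //.
  exact: vlead_term_in below_d.
- move=> qr s GMs; have [s0 _ [d sd]] := GMhom s GMs.
  apply/(has_liftingP prec_wo lt_wo prec_act s0 sd).
  have /(quasi_groebner_representationP g prec_wo lt_wo prec_act)[l] := qr s GMs.
  rewrite (syz_degree_homogeneous _ _ _ s0 sd) // => slE ld.
  (* The lifting differs from [s] only by [l], which lies below [d]. *)
  exists (s - l); first by rewrite combB slE subrr.
  by rewrite addrAC subrr; apply: vdegrees_inB => //; exact: vdegrees_in0.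
- move=> lift s /homogeneousP[s0 [d sd]] sker.
  apply/(has_liftingP prec_wo lt_wo prec_act s0 sd).
  have [r [rGM sE]] := GMspan s sker.
  (* The coefficients of the expansion in [GM] are arbitrary, but [s] is its own degree [d] part, so
     the degree [d] parts of the summands suffice. *)
  rewrite -(vcomponent_id sd) sE sum_scale_lmul.
  apply: liftable_span => // p /rGM GMp.
  have [p0 _ [e pe]] := GMhom _ GMp; exists e => //.
  by apply/(has_liftingP prec_wo lt_wo prec_act p0 pe)/lift.
move=> lift; apply/left_groebner_basisP.
apply: (weak_groebner_of_lifting prec_wo lt_wo prec_act lt_act g0).
move=> d s s0 sd sker.
apply/(has_liftingP prec_wo lt_wo prec_act s0 sd)/lift.
  by apply/homogeneousP; split=> //; exists d.
by rewrite graded_syz_mapE.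
Qed.
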